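(* Let $(X,\mathcal{A})$ be a measurable space and let $\mu\colon\mathcal{A}\to[0,\infty]$ be a nonadditive measure. The following assertions are equivalent. (i) $\mu$ is conditionally order continuous. (ii) For any $\{f_n\}_{n\in\mathbb{N}}\subset\mathcal{F}_0^+(X)$, if it satisfies (a) $f_{n+1}(x)\le f_n(x)$ for every $x\in X$ and $n\in\mathbb{N}$, (b) $f_n(x)\to 0$ for every $x\in X$, (c) $\mathrm{Ch}(\mu,f_1)<\infty$, then $\mathrm{Ch}(\mu,f_n)\to 0$.
   Context: $X$ is a nonempty set and $\mathcal{A}$ is a $\sigma$-field of subsets of $X$. A nonadditive measure is a set function $\mu\colon\mathcal{A}\to[0,\infty]$ with $\mu(\emptyset)=0$ and $\mu(A)\le\mu(B)$ whenever $A,B\in\mathcal{A}$, $A\subset B$. $\mathcal{F}_0^+(X)$ is the set of all $\mathcal{A}$-measurable functions $X\to[0,\infty)$. Conditionally order continuous: $\mu(A_n)\to 0$ whenever $\{A_n\}_{n\in\mathbb{N}}\subset\mathcal{A}$ is nonincreasing with $\bigcap_{n=1}^\infty A_n=\emptyset$ and $\mu(A_1)<\infty$. Choquet integral: $\mathrm{Ch}(\mu,f):=\int_0^\infty\mu(\{f>t\})\,dt\in[0,\infty]$ (Lebesgue integral) for $f\in\mathcal{F}_0^+(X)$. *)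

(* Defs.v *)
From mathcomp Require Import all_boot all_order all_algebra.
From mathcomp Require Import all_classical all_reals all_analysis.
Set Implicit Arguments.
Unset Strict Implicit.
Unset Printing Implicit Defensive.
Import numFieldNormedType.Exports.
Local Open Scope classical_set_scope.
Local Open Scope ring_scope.
Local Open Scope ereal_scope.

(* A set function on the sigma-field is a total function on [set X]; its values
   outside the sigma-field are never constrained or used. *)
Definition nonadditive_measure (R : realType) (d : measure_display)
    (X : measurableType d) (mu : set X -> \bar R) : Prop :=
  [/\ forall A, measurable A -> 0 <= mu A,
      mu set0 = 0
    & forall A B, measurable A -> measurable B -> A `<=` B -> mu A <= mu B].

(* Sequences are indexed from 0, so [A 0%N] is the first term. *)
Definition conditionally_order_continuous (R : realType) (d : measure_display)
    (X : measurableType d) (mu : set X -> \bar R) : Prop :=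
  forall A : nat -> set X,
    (forall n, measurable (A n)) ->
    (forall n, A n.+1 `<=` A n) ->
    \bigcap_n A n = set0 ->
    mu (A 0%N) < +oo ->
    mu (A n) @[n --> \oo] --> 0.

Definition nneg_measurable_function (R : realType) (d : measure_display)
    (X : measurableType d) (f : X -> R) : Prop :=
  measurable_fun setT f /\ forall x, (0 <= f x)%R.

Definition Choquet (R : realType) (d : measure_display)
    (X : measurableType d) (mu : set X -> \bar R) (f : X -> R) : \bar R :=
  \int[lebesgue_measure]_(t in `[0%R, +oo[) mu [set x | (t < f x)%R].

(* Main.v *)
Require Import Defs.
From mathcomp Require Import all_boot all_order all_algebra.
From mathcomp Require Import all_classical all_reals all_analysis.
From mathcomp Require Import measurable_realfun.
Import Order.TTheory GRing.Theory Num.Theory.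
Import numFieldNormedType.Exports.
Local Open Scope classical_set_scope.
Local Open Scope ring_scope.

(** For (i) => (ii), the level functions [t |-> mu {f_n > t}] decrease to 0 for
    each [t > 0], because [t * mu {f_0 > t} <= Ch(mu, f_0) < +oo], and they are
    dominated by the integrable level function of [f_0]. For (ii) => (i), apply
    (ii) to indicator functions, since [Ch(mu, 1_A) = mu A]. *)

(** For each real [r], the set where [F] exceeds [r] is closed downwards, hence an interval and
    Borel. This is how level functions become measurable from the monotonicity of [mu] alone. *)
Lemma nonincreasing_emeasurable (R : realType) (D : set R) (F : R -> \bar R) :
  measurable D -> {homo F : s t / s <= t >-> (t <= s)%E} ->
  measurable_fun D F.
Proof.
move=> mD F_ni.
apply: (measurability _ (ErealGenOInfty.measurableE R)) => _ [_ [r ->] <-].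
apply: measurableI => //; apply: is_interval_measurable => s t /=.
rewrite !in_itv /= !andbT => _ rFt u /andP[_ ut].
by rewrite in_itv /= andbT (lt_le_trans rFt)// F_ni.
Qed.

Section Choquet.
Context {R : realType} {d : measure_display} {X : measurableType d}.
Context {mu : set X -> \bar R} (mu_nonadditive : nonadditive_measure mu).
Implicit Types (f g : X -> R) (A : set X).

Lemma nonadditive_measure_ge0 A : measurable A -> (0 <= mu A)%E.
Proof. by have [mu0 _ _] := mu_nonadditive; exact: mu0. Qed.

Lemma le_nonadditive_measure A B : measurable A -> measurable B ->
  A `<=` B -> (mu A <= mu B)%E.
Proof. by have [_ _ mu_le] := mu_nonadditive; exact: mu_le. Qed.

Lemma measurable_level_set f (t : R) : nneg_measurable_function f ->
  measurable [set x | t < f x].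
Proof.
move=> [mf _].
have -> : [set x | t < f x] = setT `&` f @^-1` `]t, +oo[.
  by rewrite setTI; apply/seteqP; split => x /=; rewrite in_itv/= andbT.
exact: mf.
Qed.

Lemma measurable_level_function f (D : set R) : nneg_measurable_function f ->
  measurable D -> measurable_fun D (fun t => mu [set x | (t < f x)%R]).
Proof.
move=> mf mD; apply: nonincreasing_emeasurable => // s t st.
apply: le_nonadditive_measure; [exact: measurable_level_set..|].
by move=> x /=; exact: le_lt_trans.
Qed.

(** A single point is Lebesgue null. Removing [0] matters later: the sets [{f_n > 0}] can all be the
    whole space, possibly of infinite measure, even when [f_n] tends to 0 pointwise. *)
Lemma Choquet_obnd f : nneg_measurable_function f ->
  Choquet mu f =
  (\int[lebesgue_measure]_(t in `]0%R, +oo[) mu [set x | (t < f x)%R])%E.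
Proof.
by move=> mf; rewrite integral_itv_obnd_cbnd//; exact: measurable_level_function.
Qed.

(** A Markov-type inequality: on [[0, t[] the level function is at least its value at [t], and by
    nonnegativity the integral only grows when the domain is enlarged to the half-line. *)
Lemma level_set_le_Choquet f (t : R) : nneg_measurable_function f -> 0 < t ->
  (mu [set x | (t < f x)%R] * t%:E <= Choquet mu f)%E.
Proof.
move=> mf t0.
have <- : (\int[lebesgue_measure]_(s in `[0%R, t[)
    cst (mu [set x | (t < f x)%R]) s = mu [set x | (t < f x)%R] * t%:E)%E.
  by rewrite integral_cst//= lebesgue_measure_itv/= lte_fin t0 sube0.
apply: (@le_trans _ _
    (\int[lebesgue_measure]_(s in `[0%R, t[) mu [set x | (s < f x)%R])%E).
  apply: ge0_le_integral => //.
  - by move=> s _; apply: nonadditive_measure_ge0; exact: measurable_level_set.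
  - exact: measurable_level_function.
  - move=> s /=; rewrite in_itv/= => /andP[_ st].
    apply: le_nonadditive_measure; [exact: measurable_level_set..|].
    by move=> x /=; exact: lt_trans.
apply: ge0_subset_integral => //.
- exact: measurable_level_function.
- by move=> s _; apply: nonadditive_measure_ge0; exact: measurable_level_set.
- by move=> s /=; rewrite !in_itv/= => /andP[->].
Qed.

Lemma level_set_ltey f (t : R) : nneg_measurable_function f -> 0 < t ->
  (Choquet mu f < +oo)%E -> (mu [set x | (t < f x)%R] < +oo)%E.
Proof.
move=> mf t0 Chf; rewrite ltey; apply/eqP => muy.
have := level_set_le_Choquet _ _ mf t0.
by rewrite muy gt0_mulye ?lte_fin// leye_eq => /eqP Chy; rewrite Chy in Chf.
Qed.

(** The level set of [\1_A] at height [t] is [A] for [0 <= t < 1] and empty for [t >= 1], so the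
    level function is [mu A] times the indicator of an interval of length 1. The value [mu A = +oo]
    is covered too. *)
Lemma Choquet_indic A : measurable A -> Choquet mu \1_A = mu A.
Proof.
move=> mA; have [_ mu0 _] := mu_nonadditive.
transitivity (\int[lebesgue_measure]_(t in `[0%R, +oo[ `&` `]-oo, 1%R[)
    cst (mu A) t)%E; last first.
  rewrite integral_cst; last exact: measurableI.
  have -> : (`[0%R, +oo[ `&` `]-oo, (1 : R)[ = `[0%R, 1%R[)%classic.
    by apply/seteqP; split => t /=; rewrite !in_itv/= andbT => /andP.
  by rewrite /= lebesgue_measure_itv/= lte_fin ltr01 sube0 mule1.
(* Restriction to []-oo, 1[] becomes extension by 0 on the half-line, which leaves a pointwise
   comparison split at [t = 1]. *)
rewrite integral_mkcondr; apply: eq_integral => t.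
rewrite inE/= in_itv/= andbT => t0; rewrite patchE.
case: ifPn; rewrite ?notin_setE ?inE/= in_itv/=.
  move=> t1; congr mu; apply/seteqP; split => x /=; rewrite indicE.
    by case: (boolP (x \in A)); [rewrite inE|rewrite ltNge t0].
  by move=> Ax; rewrite mem_set.
move=> /negP; rewrite -leNgt => t1; rewrite -[RHS]mu0; congr mu.
rewrite -subset0 => x /=; rewrite indicE ltNge (le_trans _ t1)//.
by rewrite lern1 leq_b1.
Qed.

Lemma conditionally_order_continuous_Choquet (f : nat -> X -> R) :
  conditionally_order_continuous mu ->
  (forall n, nneg_measurable_function (f n)) ->
  (forall x n, f n.+1 x <= f n x) ->
  (forall x, f n x @[n --> \oo] --> (0 : R)) ->
  (Choquet mu (f 0%N) < +oo)%E ->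
  Choquet mu (f n) @[n --> \oo] --> 0%E.
Proof.
move=> muC mf f_ni f_cvg Chf.
have fle n x : f n x <= f 0%N x.
  by elim: n => // n; exact: le_trans.
have lf_ge0 n t : (0 <= mu [set x | (t < f n x)%R])%E.
  by apply: nonadditive_measure_ge0; exact: measurable_level_set.
have -> : (fun n => Choquet mu (f n)) = fun n =>
    (\int[lebesgue_measure]_(t in `]0%R, +oo[) mu [set x | (t < f n x)%R])%E.
  by apply/funext => n /=; exact: Choquet_obnd.
(* The limit is written as the integral of the zero function, to match the conclusion of dominated
   convergence in the variable [t]. *)
rewrite -(integral0 lebesgue_measure `]0%R, +oo[).
apply: (@dominated_cvg _ _ R lebesgue_measure `]0%R, +oo[ (measurable_itv _)
  (fun n t => mu [set x | t < f n x]) (cst 0%E)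
  (fun t => mu [set x | t < f 0%N x])).
- by move=> n; exact: measurable_level_function.
- move=> t /=; rewrite in_itv/= andbT => t0; apply: muC.
  + by move=> n; exact: measurable_level_set.
  + by move=> n x /= /lt_le_trans; apply.
  (* Since [t > 0], convergence to 0 puts [f n x] below [t] for some [n], so no point [x] lies in
     all the level sets. *)
  + rewrite -subset0 => x /= fx.
    have [n _ /(_ n (leqnn n)) /= fnt] := cvgr_lt _ (f_cvg x) _ t0.
    by have := fx n I; rewrite /= ltNge (ltW fnt).
  + exact: level_set_ltey.
- move=> t /=; rewrite in_itv/= andbT => t0.
  by rewrite ge0_fin_numE//; exact: level_set_ltey.
- apply/integrableP; split; first exact: measurable_level_function.
  (* The dominating function is nonnegative, so the integral of its absolute value is the Choquet
     integral of [f 0], finite by hypothesis. *)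
  under eq_integral do rewrite gee0_abs//.
  by rewrite -Choquet_obnd.
- move=> n t _; rewrite gee0_abs//.
  apply: le_nonadditive_measure; [exact: measurable_level_set..|].
  by move=> x /= /lt_le_trans; apply.
Qed.

Lemma Choquet_conditionally_order_continuous :
  (forall f : nat -> X -> R,
    (forall n, nneg_measurable_function (f n)) ->
    (forall x n, f n.+1 x <= f n x) ->
    (forall x, f n x @[n --> \oo] --> (0 : R)) ->
    (Choquet mu (f 0%N) < +oo)%E ->
    Choquet mu (f n) @[n --> \oo] --> 0%E) ->
  conditionally_order_continuous mu.
Proof.
move=> Ch_cvg A mA A_ni A0 muA.
have Ale m n : (m <= n)%N -> A n `<=` A m.
  by move=> /subnK <-; elim: (n - m)%N => // k; apply: subset_trans; exact: A_ni.
have -> : (fun n => mu (A n)) = fun n => Choquet mu \1_(A n).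
  by apply/funext => n; rewrite Choquet_indic.
apply: Ch_cvg.
- by move=> n; split; [exact: measurable_indic|move=> x; rewrite indicE].
- move=> x n; rewrite !indicE ler_nat.
  by case: (boolP (x \in A n.+1)) => //; rewrite inE => /A_ni /mem_set ->.
- move=> x.
  (* A point outside [A N] is outside every later [A n], so the sequence of indicators at [x] is
     eventually equal to 0. *)
  have [N NAx] : exists N, ~ A N x.
    apply/existsNP => Ax.
    by have : (\bigcap_n A n) x by []; rewrite A0.
  apply: cvg_near_cst; exists N => // n /= Nn.
  by rewrite indicE memNset// => /(Ale _ _ Nn).
- by rewrite Choquet_indic.
Qed.

End Choquet.

Theorem proposition6p9 (R : realType) (d : measure_display)
    (X : measurableType d)
    (mu : set X -> \bar R) (mu_nonadditive : nonadditive_measure mu) :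
  conditionally_order_continuous mu
  <->
  (forall f : nat -> X -> R,
    (forall n, nneg_measurable_function (f n)) ->
    (forall x n, f n.+1 x <= f n x) ->
    (forall x, f n x @[n --> \oo] --> (0 : R)) ->
    (Choquet mu (f 0%N) < +oo)%E ->
    Choquet mu (f n) @[n --> \oo] --> 0%E).
Proof.
split; last exact: Choquet_conditionally_order_continuous.
by move=> muC f; exact: conditionally_order_continuous_Choquet.
Qed.
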